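(* Let $\mathrm{Sort}_n(132)$ be the set of $132$-sortable permutations of length $n$ and let $\mathcal{R}_n(12231)$ be the set of restricted growth functions of length $n$ avoiding $12231$. For $\pi=\pi_1\cdots\pi_n$ with left-to-right minima $m_1>m_2>\cdots>m_k$, and with $m_0=+\infty$, let $\phi(\pi)=r_1\cdots r_n$, where $r_i=j$ if $m_j\le \pi_i<m_{j-1}$. Then $\phi:\mathrm{Sort}_n(132)\to\mathcal{R}_n(12231)$ is a bijection.
   Context: A permutation contains a pattern $\tau$ if some subsequence has the same relative order as $\tau$; otherwise it avoids $\tau$. An element $\pi_i$ of $\pi=\pi_1\cdots\pi_n$ is a left-to-right minimum if it is smaller than all of $\pi_1,\dots,\pi_{i-1}$ ($\pi_1$ is a left-to-right minimum). The $132$-stack: a permutation $\pi$ is read from left to right and passed through an initially empty stack. At each step, the next input element is pushed onto the stack if the resulting content of the stack, read from top to bottom, avoids $132$; otherwise the top element of the stack is popped and appended to the output. When the input is exhausted, all remaining elements are popped to the output, from top to bottom. The output is denoted $s_{132}(\pi)$. The sequence $s_{132}(\pi)$ is then passed in the same way through a second stack, whose content read from top to bottom must avoid $21$. The permutation $\pi$ is $132$-sortable if the final output is the identity permutation; equivalently (a standard fact on stack sorting), if $s_{132}(\pi)$ avoids $231$. A restricted growth function (RGF) of length $n$ is a sequence of positive integers $r_1\cdots r_n$ with $r_1=1$ and $r_i\le 1+\max\{r_1,\dots,r_{i-1}\}$ for $i\ge2$. The standardization $\mathrm{std}(Q)$ of an integer sequence $Q$ replaces all occurrences of its $i$-th smallest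 distinct value by $i$, for all $i$. An RGF $R$ contains $Q=q_1\cdots q_k$ if some subsequence of $R$ has standardization equal to $Q$; otherwise it avoids $Q$. *)

(* Defs.v *)
From mathcomp Require Import all_boot all_fingroup.

Set Implicit Arguments.
Unset Strict Implicit.
Unset Printing Implicit Defensive.

(* Two words with the same relative order. *)
Definition same_order (s t : seq nat) : bool :=
  (size s == size t) &&
  [forall i : 'I_(size s), [forall j : 'I_(size s),
     (nth 0 s i < nth 0 s j) == (nth 0 t i < nth 0 t j)]].

(* Subsequences of w are the words mask m w with m a bit mask of length
   size w; see containsP. *)
Definition contains (w tau : seq nat) : bool :=
  [exists m : (size w).-tuple bool, same_order (mask m w) tau].

Definition avoids (w tau : seq nat) : bool := ~~ contains w tau.

Lemma containsP (w tau : seq nat) :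
  reflect (exists2 s, subseq s w & same_order s tau) (contains w tau).
Proof.
apply: (iffP existsP) => [[m sm]|[s /subseqP [m sz_m ->] sm]].
  by exists (mask m w) => //; apply: mask_subseq.
by have /eqP sz := sz_m; exists (Tuple sz).
Qed.

(* Stack contents are listed from top to bottom.  [push tau x st] pops st until
   x can be pushed; it returns the popped letters, in order, and the new stack.
   On the empty stack x is always pushed, as the rule prescribes for every
   pattern tau of length at least 2. *)
Fixpoint push (tau : seq nat) (x : nat) (st : seq nat) : seq nat * seq nat :=
  if avoids (x :: st) tau then ([::], x :: st)
  else if st is y :: st' then
    let: (out, st'') := push tau x st' in (y :: out, st'')
  else ([::], [:: x]).

Fixpoint run_stack (tau st input : seq nat) : seq nat :=
  if input is x :: input' then
    let: (out, st') := push tau x st in out ++ run_stack tau st' input'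
  else st.

Definition stack_output (tau w : seq nat) : seq nat := run_stack tau [::] w.

Definition sortable132 (w : seq nat) : bool :=
  stack_output [:: 2; 1] (stack_output [:: 1; 3; 2] w) == iota 1 (size w).

(* One-line notation, with letters 1, ..., n. *)
Definition oneline n (pi : 'S_n) : n.-tuple nat := [tuple (pi i).+1 | i < n].

Definition Sort132 n : {set 'S_n} := [set pi | sortable132 (oneline pi)].

Definition is_rgf n (r : n.-tuple nat) : bool :=
  [forall i : 'I_n,
     if val i == 0 then tnth r i == 1
     else 0 < tnth r i <= 1 + \max_(j < n | j < i) tnth r j].

Definition std (q : seq nat) : seq nat :=
  [seq (index x (sort leq (undup q))).+1 | x <- q].

Definition rgf_contains (r q : seq nat) : bool :=
  [exists m : (size r).-tuple bool, std (mask m r) == q].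

Lemma rgf_containsP (r q : seq nat) :
  reflect (exists2 s, subseq s r & std s = q) (rgf_contains r q).
Proof.
apply: (iffP existsP) => [[m /eqP sm]|[s /subseqP [m sz_m ->] sm]].
  by exists (mask m r) => //; apply: mask_subseq.
by have /eqP sz := sz_m; exists (Tuple sz); apply/eqP.
Qed.

Definition RGF_avoiding n (q : seq nat) : pred (n.-tuple nat) :=
  [pred r | is_rgf r && ~~ rgf_contains r q].
Arguments RGF_avoiding : clear implicits.

(* The left-to-right minima, in order of appearance. *)
Definition ltr_minima (w : seq nat) : seq nat :=
  [seq nth 0 w i | i <- iota 0 (size w)
                 & all (fun y => nth 0 w i < y) (take i w)].

(* m_j <= x < m_(j-1), where m_j is the j-th entry (from 1) of ms and m_0 is
   infinite. *)
Definition in_block (ms : seq nat) (j x : nat) : bool :=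
  (nth 0 ms j.-1 <= x) && ((j == 1) || (x < nth 0 ms j.-2)).

(* The index j in {1, ..., k} of the block containing x; see blockP and
   in_block_inj for its existence and uniqueness. *)
Definition block (ms : seq nat) (x : nat) : nat :=
  (find (fun j => in_block ms j x) (iota 1 (size ms))).+1.

Definition phi n (pi : 'S_n) : n.-tuple nat :=
  [tuple block (ltr_minima (oneline pi)) (tnth (oneline pi) i) | i < n].

Lemma ltr_minima_sorted (w : seq nat) : sorted gtn (ltr_minima w).
Proof.
rewrite /ltr_minima sorted_map.
have gtn_tr : transitive gtn by move=> a b c /= H1 H2; apply: ltn_trans H2 H1.
set P := fun i => all (fun y => nth 0 w i < y) (take i w).
have : sorted ltn [seq i <- iota 0 (size w) | P i].
  by apply: (sorted_filter ltn_trans); apply: iota_ltn_sorted.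
have : all (fun i => P i && (i < size w)) [seq i <- iota 0 (size w) | P i].
  by apply/allP => i; rewrite mem_filter mem_iota add0n => /andP[->].
case: [seq i <- iota 0 (size w) | P i] => //= a s /andP[Ha].
elim: s a Ha => //= b s IH a /andP[Pa sa] /andP[Hb Hs] /andP[ab pth].
rewrite (IH b Hb Hs pth) andbT; case/andP: Hb => /allP Pb sb.
apply: Pb; rewrite -(nth_take 0 ab); apply: mem_nth.
by rewrite size_take sb.
Qed.

Lemma ltr_minima_le (w : seq nat) (x : nat) :
  x \in w -> exists2 m, m \in ltr_minima w & m <= x.
Proof.
move=> xw; have [i le_ix] : exists i, i < size w /\ nth 0 w i <= x.
  by exists (index x w); rewrite index_mem nth_index.
elim/ltn_ind: i le_ix => i IH [si ix].
case: (boolP (all (fun y => nth 0 w i < y) (take i w))) => [Hi|].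
  exists (nth 0 w i) => //; apply/mapP; exists i => //.
  by rewrite mem_filter Hi mem_iota add0n.
case/allPn => y /(nthP 0) [j]; rewrite size_take si => ji <-.
rewrite -leqNgt nth_take // => Hj.
by apply: (IH j ji); split; [apply: ltn_trans ji si | apply: leq_trans Hj ix].
Qed.

Lemma blockP (w : seq nat) (x : nat) (ms := ltr_minima w) (j := block ms x) :
  x \in w -> 1 <= j <= size ms /\ in_block ms j x.
Proof.
move=> xw; set P := fun j => in_block ms j x.
have hasP : has P (iota 1 (size ms)).
  have [m mms mx] := ltr_minima_le xw.
  have hm : has (fun m => m <= x) ms by apply/hasP; exists m.
  have fm := hm; rewrite has_find in fm.
  apply/hasP; exists (find (fun m => m <= x) ms).+1.
    by rewrite mem_iota ltnS add1n ltnS.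
  rewrite /P /in_block /= (nth_find 0 hm) /= eqSS.
  case E: (find _ ms) => [|k] //=.
  by rewrite ltnNge (@before_find _ 0 (fun m => m <= x)) // E.
have := hasP; rewrite has_find size_iota => lt; split; first exact: lt.
by have := nth_find 0 hasP; rewrite nth_iota.
Qed.

Lemma in_block_inj (w : seq nat) (x i j : nat) (ms := ltr_minima w) :
  1 <= i <= size ms -> 1 <= j <= size ms ->
  in_block ms i x -> in_block ms j x -> i = j.
Proof.
wlog lt_ij : i j / i < j => [H Hi Hj Bi Bj|].
  case: (ltngtP i j) => // lt; [exact: H | exact/esym/H].
case: i j lt_ij => [|i] [|[|j]] //= lt /= si sj /andP[Bi _] /andP[_ Bj].
have gtn_tr : transitive gtn by move=> a b c /= H1 H2; apply: ltn_trans H2 H1.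
rewrite !ltnS in lt.
have : nth 0 ms j <= nth 0 ms i.
  move: lt; rewrite leq_eqVlt => /predU1P[->//|ij]; apply: ltnW.
  apply: (sorted_ltn_nth gtn_tr 0 (ltr_minima_sorted w)) => //.
  by rewrite inE; apply: ltn_trans sj.
by move: Bj => /= Bj H; move: (leq_trans Bj (leq_trans H Bi)); rewrite ltnn.
Qed.

(* Main.v *)
Require Import Defs.
From mathcomp Require Import all_boot all_fingroup.
From mathcomp Require Import zify.

Set Implicit Arguments.
Unset Strict Implicit.
Unset Printing Implicit Defensive.

(** Let w be the one-line word of a permutation, with left-to-right minima
    m_1 > ... > m_k, and call the other letters non-minima.

    In the first stack the minima never leave before the input ends: read from
    top to bottom they increase, so they cannot supply both larger letters of
    a 132.  A new minimum x pops every non-minimum y, because y lies above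
    some minimum m with x < m < y.  Hence the output of the first stack is
    L ++ [m_k; ...; m_1], where L lists the non-minima.  As m_k is smaller than
    everything else and comes after L, an ascent in L is the start of a 231,
    and the second stack sorts the word if and only if L is decreasing
    ([sorted21_output]).

    Say that a non-minimum y is separated once some letter after y belongs to
    a block of larger index than the block of y, that is, once a letter z with
    z < m <= y for a minimum m has been read.  Such a z pops y, if y is still in
    the stack, through the pattern z, y, m.  As long as the flushed output L is
    decreasing, the converse holds: the non-minima in the stack are exactly the
    unseparated ones.  So L stays decreasing when a non-minimum x arrives if and
    only if the earlier non-minima below x are exactly those not separated by
    then ([stack132P], [sortable132E]).

    This criterion speaks of the letters of phi only: in a sortable
    permutation the comparison of the entries at p < q is a function [before]
    of the word r of blocks ([well_placed_before]).  Hence phi is injective.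
    A later non-minimum q in an earlier block is larger than the non-minimum p
    whatever happens in between, so p must be unseparated at q; that is the
    absence of 12231 in r ([well_placed_avoids], [avoids_unbroken]).

    For surjectivity, [before r] is the restriction to p < q of a
    lexicographic order on positions, realized by the numbers [key r p].  The
    permutation with this order has r as its word of blocks ([order_rgf]),
    since a restricted growth function is determined by the comparisons
    between its letters ([rgf_eq]), and it meets the criterion when r avoids
    12231. *)

Lemma gtn_trans : transitive gtn.
Proof. by move=> a b c /= H1 H2; apply: ltn_trans H2 H1. Qed.

(** * Pattern containment for 132 and 21 *)

Lemma contains_subseq (w v tau : seq nat) :
  subseq w v -> contains w tau -> contains v tau.
Proof.
move=> wv /containsP[s sw so]; apply/containsP; exists s => //.
exact: subseq_trans sw wv.
Qed.

Lemma contains132P (w : seq nat) :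
  reflect (exists a b c, subseq [:: a; b; c] w /\ a < c < b)
          (contains w [:: 1; 3; 2]).
Proof.
apply: (iffP (containsP _ _)) => [[s]|[a [b [c [sw H]]]]].
  case: s => [|a [|b [|c [|? ?]]]]; rewrite /same_order //= => sw /forallP so.
  have h i j (li : i < 3) (lj : j < 3) :=
    eqP (forallP (so (Ordinal li)) (Ordinal lj)).
  exists a, b, c; split=> //.
  have /= -> := h 0 2 isT isT.
  by have /= -> := h 2 1 isT isT.
exists [:: a; b; c]; rewrite // /same_order eqxx /=.
apply/forallP => -[[|[|[|i]]] //= ?]; apply/forallP => -[[|[|[|j]]] //= ?]; lia.
Qed.

Lemma avoids21 (w : seq nat) : avoids w [:: 2; 1] = sorted leq w.
Proof.
apply/idP/idP => [|sw].
  rewrite (sorted_pairwise leq_trans); elim: w => //= x w IH av.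
  apply/andP; split; last first.
    by apply: IH; apply: contra av; apply/contains_subseq/subseq_cons.
  apply/allP => y yw; rewrite leqNgt; apply: contra av => yx.
  apply/containsP; exists [:: x; y]; first by rewrite /= eqxx sub1seq.
  rewrite /same_order eqxx /=.
  by apply/forallP => -[[|[|i]] //= ?]; apply/forallP => -[[|[|j]] //= ?]; lia.
apply/containsP => -[[|a [|b [|? ?]]] sab]; rewrite /same_order //= => /forallP so.
have /= /eqP := forallP (so (Ordinal (isT : 1 < 2))) (Ordinal (isT : 0 < 2)).
have := subseq_sorted leq_trans sab sw => /=; lia.
Qed.

(** * Runs of a stack *)

(** One step of the machine, on a pair (output so far, stack).  Folding it from
    the left allows induction on the input by its last letter, which the
    recursion of [run_stack] from the front does not. *)
Definition feed (tau : seq nat) (s : seq nat * seq nat) (x : nat) :=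
  let: (out, st) := push tau x s.2 in (s.1 ++ out, st).

Lemma run_stackE tau s w (f := foldl (feed tau) s w) :
  s.1 ++ run_stack tau s.2 w = f.1 ++ f.2.
Proof.
rewrite /f {f}; elim: w s => //= x w IH s.
rewrite -IH /feed; case: push => out st /=.
by rewrite catA.
Qed.

(** Popping stops at M at the latest if x may sit on M, so only the part S above
    M is affected: S1 is popped and S2 kept.  The last clause records why each
    letter of S1 had to go. *)
Lemma push_above tau x (S M : seq nat) : avoids (x :: M) tau ->
  exists S1 S2, [/\ S = S1 ++ S2, push tau x (S ++ M) = (S1, x :: S2 ++ M),
    avoids (x :: S2 ++ M) tau &
    forall T1 y T2, S1 = T1 ++ y :: T2 ->
      contains (x :: y :: T2 ++ S2 ++ M) tau].
Proof.
move=> avM; elim: S => [|y S [S1 [S2 [-> IH1 IH2 IH3]]]].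
  exists [::], [::]; split=> //; last by case.
  by case: M avM => [|m M] /= ->.
case av : (avoids (x :: y :: (S1 ++ S2) ++ M) tau).
  exists [::], (y :: S1 ++ S2); split=> //; last by case.
  by rewrite /= av.
exists (y :: S1), S2; split => //.
  by rewrite cat_cons /= av IH1.
case=> [|z T1] y' T2 /=; last by case=> _ /IH3.
by case=> <- <-; move/negbFE: av; rewrite catA.
Qed.

Lemma perm_push tau x st (p := push tau x st) :
  perm_eq (p.1 ++ p.2) (x :: st).
Proof.
rewrite /p {p}; elim: st => [|y st IH] /=; case: ifP => // _.
case: push IH => out st' /= IH.
by rewrite (perm_trans (y := y :: x :: st)) ?perm_cons //
  -(perm_rot 1) /= rot1_cons perm_cons perm_rcons.
Qed.

Lemma perm_run_stack tau st w : perm_eq (run_stack tau st w) (st ++ w).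
Proof.
elim: w st => [|x w IH] st /=; first by rewrite cats0.
have := perm_push tau x st; case: push => out st' /= H.
rewrite (perm_trans (y := out ++ (st' ++ w))) ?perm_cat2l //.
rewrite catA (perm_trans (y := (x :: st) ++ w)) ?perm_cat2r //.
by rewrite -cat1s perm_sym -[x :: w]cat1s perm_catCA.
Qed.

(** * Sorting by the 21-stack *)

Lemma push21E x (st : seq nat) : sorted leq st -> x \notin st ->
  push [:: 2; 1] x st = ([seq y <- st | y < x], x :: [seq y <- st | x < y]).
Proof.
elim: st => [|y st IH] /= srt; rewrite ?inE ?negb_or avoids21 //=.
case/andP=> xy xst; have [yst srt'] := (order_path_min leq_trans srt, path_sorted srt).
rewrite srt andbT; case: (ltngtP x y) xy => //= lt _; last by rewrite IH.
have all_gt z : z \in st -> x < z.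
  by move=> /(allP yst) /=; apply: leq_trans.
rewrite (eq_in_filter (a2 := pred0)) => [|z /all_gt]; last first.
  by rewrite /= ltnNge leq_eqVlt negb_or => /andP[_ /negbTE].
by rewrite filter_pred0 (eq_in_filter (a2 := predT)) ?filter_predT // => z /all_gt ->.
Qed.

Lemma uniq_pushed (p : pred nat) x st v :
  uniq (st ++ x :: v) -> uniq ((x :: [seq y <- st | p y]) ++ v).
Proof.
rewrite -cat1s uniq_catCA cat1s; apply: subseq_uniq.
by rewrite /= eqxx cat_subseq // filter_subseq.
Qed.

(** Merging: an arrival x pops exactly the smaller letters, and all that leaves
    after them is at least x. *)
Lemma run21_increasing st w : sorted ltn st -> sorted ltn w -> uniq (st ++ w) ->
  sorted leq (run_stack [:: 2; 1] st w).
Proof.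
have leq_lt s : sorted ltn s -> sorted leq s by apply: sub_sorted => ? ?; apply: ltnW.
elim: w st => [|x w IH] st sst /= sw; first by move=> _; exact: leq_lt.
move=> Hu; have xst : x \notin st.
  move: Hu; rewrite uniq_catC /= mem_cat negb_or; case/andP => /andP[] //.
rewrite push21E //=; last exact: leq_lt.
rewrite (sorted_pairwise leq_trans) pairwise_cat -!(sorted_pairwise leq_trans).
apply/and3P; split.
- apply/allrelP => a b; rewrite mem_filter => /andP[ax _].
  rewrite (perm_mem (perm_run_stack _ _ _)) mem_cat inE mem_filter.
  have := allP (order_path_min ltn_trans sw) b => H.
  case/orP => [/predU1P[->|/andP[xb _]]|/H xb]; apply: ltnW => //; exact: ltn_trans xb.
- by apply/leq_lt/(sorted_filter ltn_trans).
apply: IH; first 2 last.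
- exact: uniq_pushed Hu.
- rewrite /= (path_sortedE ltn_trans) (sorted_filter ltn_trans) // andbT.
  exact: filter_all.
- exact: path_sorted sw.
Qed.

(** Each letter of L is below the top of the stack when it arrives, so nothing
    is popped. *)
Lemma run21_decreasing st L M : sorted leq (rev L ++ st) ->
  run_stack [:: 2; 1] st (L ++ M) = run_stack [:: 2; 1] (rev L ++ st) M.
Proof.
elim: L st => //= x L IH st; rewrite rev_cons cat_rcons => srt.
have xst : sorted leq (x :: st) by case/cat_sorted2: srt.
by case: st xst {srt} (IH _ srt) => [|y st] xst <-; rewrite /= avoids21 xst.
Qed.

(** The letters a, b, c form a 231: a has left the stack at the latest when
    b > a arrives, hence before c < a has been read. *)
Lemma run21_descent st w1 w2 a b c :
  sorted leq st -> uniq (st ++ w1 ++ b :: w2) -> a \in st ++ w1 -> c \in w2 ->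
  c < a < b -> ~~ sorted leq (run_stack [:: 2; 1] st (w1 ++ b :: w2)).
Proof.
move=> sst u ast cw /andP[ca ab]; apply/negP.
have swap (o r : seq nat) : a \in o -> c \in r -> ~ sorted leq (o ++ r).
  rewrite (sorted_pairwise leq_trans) pairwise_cat => ao cr /and3P[/allrelP h _ _].
  by have := h _ _ ao cr; rewrite leqNgt ca.
elim: w1 st sst u ast => [|x w1 IH] st sst; rewrite ?cats0 => u ast /=.
  have bst : b \notin st.
    by move: u; rewrite uniq_catC /= mem_cat negb_or; case/andP => /andP[].
  rewrite push21E //=; apply: swap; first by rewrite mem_filter ab.
  by rewrite (perm_mem (perm_run_stack _ _ _)) mem_cat cw orbT.
have xst : x \notin st.
  by move: u; rewrite uniq_catC /= mem_cat negb_or; case/andP => /andP[].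
rewrite push21E //=.
case: (boolP (a \in [seq y <- st | y < x])) => [ax|].
  apply: swap => //.
  by rewrite (perm_mem (perm_run_stack _ _ _)) !(mem_cat, inE) cw !orbT.
rewrite mem_filter negb_and -leqNgt => ax /cat_sorted2[_]; apply: IH.
- rewrite /= (path_sortedE leq_trans) (sorted_filter leq_trans) // andbT.
  by apply/allP => y; rewrite mem_filter => /andP[/ltnW].
- exact: uniq_pushed u.
move: ast ax; rewrite !mem_cat !inE mem_filter.
by case: (a \in st) (a \in w1) => [] [] //=; rewrite ?orbT //; case: ltngtP.
Qed.

Lemma sorted_gtn_split (L : seq nat) :
  (forall L1 b L2 a, L = L1 ++ b :: L2 -> a \in L1 -> b < a) -> sorted gtn L.
Proof.
rewrite (sorted_pairwise gtn_trans).
elim/last_ind: L => // L x IH H; rewrite pairwise_rcons; apply/andP; split.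
  by apply/allP => a aL; apply: (H L x [::]); rewrite ?cats1.
by apply: IH => L1 b L2 a eL; apply: (H _ _ (rcons L2 x)); rewrite eL rcons_cat.
Qed.

(** An ascent in L is completed to a 231 by a letter of M, since every letter
    of L has a smaller one in M.  Conversely a decreasing L becomes an
    increasing stack, into which M is merged. *)
Lemma sorted21_output (L M : seq nat) :
  uniq (L ++ M) -> sorted ltn M -> (forall y, y \in L -> exists2 m, m \in M & m < y) ->
  sorted leq (stack_output [:: 2; 1] (L ++ M)) = sorted gtn L.
Proof.
move=> u sM LM; apply/idP/idP => [H|sL].
  apply: sorted_gtn_split => L1 b L2 a eL aL1; rewrite ltnNge leq_eqVlt negb_or.
  apply/andP; split.
    apply: contraTN u => /eqP ab; have bL1 : b \in L1 by rewrite -ab.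
    by rewrite eL -catA cat_uniq /= bL1 !andbF.
  have [m mM ma] : exists2 m, m \in M & m < a by apply: LM; rewrite eL mem_cat aL1.
  apply: contraTN H => ab; rewrite eL -catA.
  apply: (@run21_descent _ _ _ a b m) => //.
  - by rewrite cat0s -cat_cons catA -eL.
  - by rewrite mem_cat mM orbT.
  - by rewrite ma.
have srL : sorted ltn (rev L) by rewrite rev_sorted.
rewrite /stack_output run21_decreasing cats0.
  apply: run21_increasing => //; move: u.
  by rewrite !cat_uniq rev_uniq (eq_has (mem_rev L)).
by apply: sub_sorted srL => ? ?; apply: ltnW.
Qed.

(** * Left-to-right minima and blocks *)

(** The number of minima above x is the index, counted from 0, of the block of
    x (see [blockE]).  Unlike the search defining [block] it makes the block
    comparable between letters ([row_lt]) and stable under extension of the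
    word ([row_cat]). *)
Definition row (w : seq nat) (x : nat) := count (ltn x) (ltr_minima w).

Lemma ltr_minima_rcons w x :
  ltr_minima (rcons w x) = ltr_minima w ++ (if all (ltn x) w then [:: x] else [::]).
Proof.
rewrite /ltr_minima size_rcons -addn1 iotaD filter_cat map_cat; congr (_ ++ _).
  have E i : i \in iota 0 (size w) -> nth 0 (rcons w x) i = nth 0 w i.
    by rewrite mem_iota nth_rcons => /= ->.
  rewrite (eq_in_filter (a2 := fun i => all (fun y => nth 0 w i < y) (take i w))).
    by apply/eq_in_map => i; rewrite mem_filter => /andP[_ /E].
  move=> i iw; rewrite (E i iw) -cats1 take_cat.
  by move: iw; rewrite mem_iota => /= ->.
rewrite add0n /= nth_rcons ltnn eqxx -cats1 take_size_cat //.
by case: ifP => //=; rewrite nth_cat ltnn subnn.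
Qed.

(** A minimum created by an extension lies below the whole of w, so it does
    not change the block of any letter of w. *)
Lemma ltr_minima_cat w v : exists2 t, ltr_minima (w ++ v) = ltr_minima w ++ t
  & {in t & w, forall m y, m < y}.
Proof.
elim/last_ind: v => [|v x [t IH Ht]]; first by exists [::]; rewrite ?cats0.
rewrite -rcons_cat ltr_minima_rcons IH -catA; eexists; first by [].
move=> m y; rewrite mem_cat => /orP[mt|]; first exact: Ht.
case: ifP => // xall; rewrite inE => /eqP -> yw.
by apply: (allP xall); rewrite mem_cat yw.
Qed.

Lemma row_cat w v x : x \in w -> row (w ++ v) x = row w x.
Proof.
move=> xw; have [t Et Ht] := ltr_minima_cat w v.
rewrite /row Et count_cat [X in _ + X](_ : _ = 0) ?addn0 //.
apply/eqP; rewrite -leqn0 leqNgt -has_count; apply/hasPn => m mt /=.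
by rewrite -leqNgt ltnW ?Ht.
Qed.

Lemma ltr_minima_subseq w : subseq (ltr_minima w) w.
Proof.
elim/last_ind: w => // w x IH; rewrite ltr_minima_rcons -cats1.
by case: ifP => _; apply: cat_subseq.
Qed.

Lemma row_lt w x y :
  (row w x < row w y) = has (fun m => y < m <= x) (ltr_minima w).
Proof.
rewrite /row has_count; set s := ltr_minima w; case: (leqP x y) => [xy|yx].
  rewrite ltnNge sub_count => [|m /=]; last exact: leq_ltn_trans.
  by rewrite (eq_count (a2 := pred0)) ?count_pred0 // => m /=; lia.
rewrite -{1}[count (ltn x) s]addn0 (_ : count (ltn y) s =
  count (ltn x) s + count (fun m => y < m <= x) s) ?ltn_add2l //.
by elim: s => //= m s ->; lia.
Qed.

(** * The first stack *)

Definition separated w y :=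
  has (fun z => row w y < row w z) (drop (index y w) w).

(** The letter x read after w compares with each earlier non-minimum the way a
    decreasing output requires. *)
Definition placed w x :=
  all (fun y => (y \in ltr_minima w) || ((y < x) == ~~ separated (rcons w x) y)) w.

Definition well_placed w :=
  all (fun q => all (ltn (nth 0 w q)) (take q w) || placed (take q w) (nth 0 w q))
      (iota 0 (size w)).

Lemma well_placed_rcons w x :
  well_placed (rcons w x) = well_placed w && (all (ltn x) w || placed w x).
Proof.
rewrite /well_placed size_rcons -addn1 iotaD all_cat add0n all_seq1.
rewrite nth_rcons ltnn eqxx -cats1 take_size_cat //; congr (_ && _).
apply: eq_in_all => q; rewrite mem_iota /= => qw.
by rewrite nth_cat qw take_cat qw.
Qed.

Lemma separated_rcons w x y : y \in w ->
  separated (rcons w x) y =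
  separated w y || has (fun m => x < m <= y) (ltr_minima w).
Proof.
move=> yw; rewrite /separated -cats1 index_cat yw drop_cat index_mem yw.
rewrite has_cat has_seq1 row_lt; congr (_ || _).
  apply: eq_in_has => z /mem_drop zw; by rewrite !row_cat.
rewrite cats1 ltr_minima_rcons has_cat; case: ifP; rewrite /= ?orbF //.
by rewrite ltnn /= orbF.
Qed.

Lemma separated_last w x : x \notin w -> separated (rcons w x) x = false.
Proof.
move=> xw; rewrite /separated -cats1 index_cat (negbTE xw) /= eqxx addn0.
by rewrite drop_size_cat //= ltnn.
Qed.

(** If only the arrival of x creates a 132, then x plays the smallest role,
    and letters of A below x take no part. *)
Lemma new132 x A M : avoids (A ++ M) [:: 1; 3; 2] -> contains (x :: A ++ M) [:: 1; 3; 2] ->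
  exists b c, subseq [:: b; c] ([seq y <- A | x < y] ++ M) /\ x < c < b.
Proof.
move=> avst /contains132P[a [b [c [sub acb]]]].
have [ax bc] : a = x /\ subseq [:: b; c] (A ++ M).
  move: sub => /=; case: eqP => // _ sub; case/negP: avst; apply/contains132P.
  by exists a, b, c.
exists b, c; rewrite -ax; split=> //.
have : subseq [:: b; c] [seq y <- A ++ M | a < y].
  by rewrite subseq_filter bc /= andbT; lia.
rewrite filter_cat => H; apply: subseq_trans H _.
by apply: cat_subseq => //; apply: filter_subseq.
Qed.

Lemma increasing_no132 x M : sorted ltn M -> avoids (x :: M) [:: 1; 3; 2].
Proof.
move=> sM; apply/contains132P => -[a [b [c [sub acb]]]].
have : subseq [:: b; c] M.
  by move: sub => /=; case: ifP => // _ /cons_subseq.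
move=> /(subseq_sorted ltn_trans)/(_ sM) /=; lia.
Qed.

Definition stack132 w := foldl (feed [:: 1; 3; 2]) ([::], [::]) w.

Lemma perm_stack132 w : perm_eq ((stack132 w).1 ++ (stack132 w).2) w.
Proof.
have := run_stackE [:: 1; 3; 2] ([::], [::]) w => /= <-.
exact: perm_run_stack.
Qed.

Lemma sorted_rev_minima w : sorted ltn (rev (ltr_minima w)).
Proof. by rewrite rev_sorted; apply: ltr_minima_sorted. Qed.

(** The invariant of the first stack.  The minima sit at the bottom, below some
    S of non-minima, and the output followed by S is the list of non-minima as
    it would be flushed now.  It is decreasing exactly when all letters so far
    are well placed, and in that case the stack has retained exactly the
    unseparated non-minima, which is what makes the next step predictable. *)
Lemma stack132P w : uniq w -> exists S,
  [/\ (stack132 w).2 = S ++ rev (ltr_minima w),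
      avoids (stack132 w).2 [:: 1; 3; 2],
      sorted gtn ((stack132 w).1 ++ S) = well_placed w
    & well_placed w -> all (separated w) (stack132 w).1 /\
                all (predC (separated w)) S].
Proof.
elim/last_ind: w => [_|w x IH u].
  exists [::]; split=> //; apply/contains132P => -[a [b [c []]]] //.
have [xw uw] : x \notin w /\ uniq w by move: u; rewrite rcons_uniq => /andP.
have {IH} [S [eS av sL sepL]] := IH uw.
have := perm_stack132 w; rewrite /stack132 foldl_rcons -/(stack132 w).
move: eS av sL sepL; case: (stack132 w) => O st /= -> av sL sepL.
set M := rev _; move=> pe; have sM : sorted ltn M := sorted_rev_minima w.
have memM m : (m \in M) = (m \in ltr_minima w) by rewrite mem_rev.
have minw m : m \in M -> m \in w.
  by rewrite memM; apply/mem_subseq/ltr_minima_subseq.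
have uOSM : uniq (O ++ S ++ M) by rewrite (perm_uniq pe).
have inw y : (y \in w) = (y \in O ++ S) || (y \in M).
  by rewrite -(perm_mem pe) !mem_cat orbA.
have notM y : y \in O ++ S -> y \notin M.
  by move: uOSM; rewrite catA cat_uniq => /and3P[_ /hasPn H _] yL; apply: contraL yL => /H.
rewrite /feed /=; have [S1 [S2 [eS -> av' stop]]] := push_above S (increasing_no132 x sM).
rewrite /= well_placed_rcons; case: (boolP (all (ltn x) w)) => /= [xmin|xnmin].
(* A new minimum x.  A letter y left above M would give the pattern x, y, m
   with m a minimum below y. *)
- have eS2 : S2 = [::].
    case: S2 eS av' {stop} => // y S2 eS /contains132P[].
    have yL : y \in O ++ S by rewrite eS !mem_cat inE eqxx !orbT.
    have yw : y \in w by rewrite inw yL.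
    have [m mm my] := ltr_minima_le yw.
    have xm : x < m by apply: (allP xmin); rewrite minw ?memM.
    exists x, y, m; split.
      rewrite /= eqxx eqxx sub1seq mem_cat memM mm orbT //.
    rewrite xm ltn_neqAle my andbT; apply: contraNneq (notM _ yL) => <-.
    by rewrite memM.
  rewrite eS2 cats0 in eS *; exists [::].
  rewrite eS2 in av'; rewrite ltr_minima_rcons xmin rev_cat cats0 andbT; split=> //.
    by rewrite -eS.
  rewrite -eS => _; split=> //; apply/allP => y yL.
  have yw : y \in w by rewrite inw yL.
  have [m mm my] := ltr_minima_le yw.
  rewrite separated_rcons //; apply/orP; right; apply/hasP; exists m => //.
  by rewrite my andbT; apply: (allP xmin); rewrite minw ?memM.
have eM : ltr_minima (rcons w x) = ltr_minima w.
  by rewrite ltr_minima_rcons (negbTE xnmin) cats0.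
(* A non-minimum x: inserted between the popped S1 and the kept S2, it leaves
   the flushed list decreasing iff it is below O and S1 and above S2. *)
exists (x :: S2); rewrite eM.
have sortedE : sorted gtn ((O ++ S1) ++ x :: S2) =
    [&& sorted gtn (O ++ S), all (ltn x) (O ++ S1) & all (gtn x) S2].
  rewrite !(sorted_pairwise gtn_trans) eS catA [in RHS]pairwise_cat pairwise_cat allrel_consr /=.
  rewrite (eq_all (a2 := ltn x)) //.
  case: (all _ (O ++ S1)); case: (all _ S2); case: (allrel _ _ _);
  by case: (pairwise _ (O ++ S1)); case: (pairwise _ S2).
suff core : well_placed w -> sorted gtn ((O ++ S1) ++ x :: S2) = placed w x /\
    (placed w x -> all (separated (rcons w x)) (O ++ S1) /\
                   all (predC (separated (rcons w x))) (x :: S2)).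
  split=> //; last by case/andP=> gw; have [_] := core gw.
  case gw: (well_placed w); first by case: (core gw).
  by rewrite sortedE sL gw.
move=> gw; have [sepO nsepS] := sepL gw; rewrite gw eS in sL nsepS sortedE.
have inLw y : y \in O ++ S1 ++ S2 -> y \in w by rewrite inw eS => ->.
set sep' := separated (rcons w x).
have sepE y : y \in S1 ++ S2 -> sep' y = has (fun m => x < m <= y) (ltr_minima w).
  move=> yS; rewrite /sep' separated_rcons; last by rewrite inLw // mem_cat yS orbT.
  by rewrite (negbTE (allP nsepS _ yS)).
have sepO' : all sep' O.
  apply/allP => y yO; rewrite /sep' separated_rcons ?(allP sepO) //.
  by rewrite inLw // mem_cat yO.
(* A separated letter cannot survive under x. *)
have sepS2 : all (predC sep') S2.
  apply/allP => y yS2 /=; rewrite sepE ?mem_cat ?yS2 ?orbT //.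
  apply/hasPn => m mm; apply: contraTN av' => /andP[xm my].
  apply/negPn/contains132P; exists x, y, m; split.
    rewrite /= eqxx; apply: (cat_subseq (s1 := [:: y]) (s2 := [:: m])).
      by rewrite sub1seq.
    by rewrite sub1seq memM.
  rewrite xm ltn_neqAle my andbT; apply: contraNneq (notM y _) => [<-|].
    by rewrite memM.
  by rewrite eS !mem_cat yS2 !orbT.
have xNL y : y \in O ++ S1 ++ S2 -> y != x.
  by move=> /inLw yw; apply: contraNneq xw => <-.
have wL y : y \in w -> y \notin ltr_minima w -> y \in O ++ S1 ++ S2.
  by rewrite inw memM eS => /orP[] // ->.
have placedP : reflect (forall y, y \in O ++ S1 ++ S2 -> (y < x) = ~~ sep' y) (placed w x).
  apply: (iffP allP) => [H y yL|H y yw].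
    have := H y (inLw _ yL); rewrite -memM (negbTE (notM y _)) ?eS //.
    by move/eqP.
  by case: (boolP (y \in _)) => //= ym; rewrite H ?wL.
have sS12 : pairwise gtn (S1 ++ S2).
  by move: sL; rewrite (sorted_pairwise gtn_trans) pairwise_cat => /and3P[].
(* Why a letter y of S1 was popped: the larger letters b, c of a 132. *)
have pairE y T1 T2 : S1 = T1 ++ y :: T2 ->
    exists b c, subseq [:: b; c] ([seq z <- y :: T2 ++ S2 | x < z] ++ M) /\ x < c < b.
  move=> eS1; apply: new132; last by have := stop _ _ _ eS1; rewrite /= catA.
  apply: contra av; rewrite eS eS1; apply: contains_subseq.
  by rewrite -!catA /= -!catA suffix_subseq.
have noM b c : subseq [:: b; c] M -> x < c < b -> False.
  move=> /(subseq_sorted ltn_trans)/(_ sM) /=; rewrite andbT => bc.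
  by case/andP=> _ /(ltn_trans bc); rewrite ltnn.
(* If the list stays decreasing, the last and least popped letter t is the only
   candidate for b, and c is a minimum below it; c then separates all of S1. *)
have S1sorted : sorted gtn ((O ++ S1) ++ x :: S2) -> all sep' S1.
  rewrite sortedE sL /= => /andP[gt /allP lt].
  have [-> //|[T1 [t eS1]]] : S1 = [::] \/ exists T1 t, S1 = rcons T1 t.
    by case: (lastP S1) => [|T1 t]; [left | right; exists T1, t].
  have [|b [c [sub xcb]]] := pairE t T1 [::]; first by rewrite eS1 cats1.
  move: sub; rewrite /= (eq_in_filter (a2 := pred0)); last first.
    by move=> z /lt /= zx; rewrite ltnNge ltnW.
  rewrite filter_pred0; case: ifP => _ /=; last by move/noM/(_ xcb).
  case: eqP => [bt|_]; last by move/noM/(_ xcb).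
  rewrite sub1seq => cM; apply/allP => y yS1.
  have ty : t <= y.
    move: sS12 yS1; rewrite eS1 pairwise_cat pairwise_rcons => /and3P[_ /andP[/allP h _] _].
    by rewrite mem_rcons inE => /predU1P[->|/h /ltnW].
  rewrite sepE; last by rewrite mem_cat yS1.
  apply/hasP; exists c; rewrite -?memM //.
  by move: xcb; rewrite bt => /andP[-> /ltnW ct]; apply: leq_trans ct ty.
(* An unseparated letter y of S1 would be below x, with only letters below x
   between y and M, and M alone contains no descent. *)
have S1placed : placed w x -> all sep' S1.
  move=> pl; apply/allP => y yS1; apply: contraT => nsep.
  have yx : y < x by rewrite (placedP pl) ?nsep // !mem_cat yS1 orbT.
  have [T1 [T2 eS1]] : exists T1 T2, S1 = T1 ++ y :: T2.
    by case/splitPr: yS1 => T1 T2; exists T1, T2.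
  have [b [c [sub xcb]]] := pairE y T1 T2 eS1.
  move: sub; rewrite (eq_in_filter (a2 := pred0)) ?filter_pred0 => [/noM/(_ xcb) //|z].
  rewrite inE => zT.
  have zy : z <= y.
    move: sS12; rewrite eS1 -catA pairwise_cat /= => /and4P[_ _ /allP h _].
    by case/predU1P: zT => [->|/h /ltnW].
  by rewrite ltnNge (leq_trans zy) // ltnW.
split.
  apply/idP/idP => [srt|pl].
    have := S1sorted srt; move: srt; rewrite sortedE sL /= => /andP[gt lt] sepS1.
    apply/placedP => y; rewrite catA mem_cat => /orP[yOS|yS2].
      have := allP gt _ yOS => /= xy; rewrite ltnNge ltnW //=.
      have : all sep' (O ++ S1) by rewrite all_cat sepO'.
      by move=> /allP/(_ _ yOS) ->.
    by have /= -> := allP lt _ yS2; have /= -> := allP sepS2 _ yS2.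
  have sepOS : all sep' (O ++ S1) by rewrite all_cat sepO' S1placed.
  rewrite sortedE sL /=; apply/andP; split; apply/allP => y yL /=.
    have yL' : y \in O ++ S1 ++ S2 by rewrite catA mem_cat yL.
    rewrite ltn_neqAle eq_sym xNL //= leqNgt (placedP pl) //.
    by rewrite negbK (allP sepOS).
  rewrite (placedP pl); last by rewrite !mem_cat yL !orbT.
  exact: (allP sepS2).
move=> pl; split; first by rewrite all_cat sepO' S1placed.
by rewrite /= /sep' separated_last.
Qed.

(** * Sortable permutations through their words of blocks *)

Lemma sortable132E w : perm_eq w (iota 1 (size w)) -> sortable132 w = well_placed w.
Proof.
move=> pw; have uw : uniq w by rewrite (perm_uniq pw) iota_uniq.
have [S [eS _ <- _]] := stack132P uw; have := perm_stack132 w.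
rewrite /sortable132 /stack_output.
have /= -> := run_stackE [:: 1; 3; 2] ([::], [::]) w.
rewrite -/(stack132 w) eS catA => pe; set L := _ ++ S in pe *; set M := rev _ in pe *.
have uLM : uniq (L ++ M) by rewrite (perm_uniq pe).
rewrite -(sorted21_output uLM (sorted_rev_minima w)) => [|y yL].
  have pe' := perm_trans (perm_run_stack [:: 2; 1] [::] (L ++ M)) (perm_trans pe pw).
  apply/eqP/idP => [|srt]; first by rewrite /stack_output => ->; exact: iota_sorted.
  exact: (sorted_eq leq_trans anti_leq srt (iota_sorted _ _) pe').
(* Every non-minimum exceeds some minimum, so an ascent gives a 231. *)
have [m mm my] : exists2 m, m \in ltr_minima w & m <= y.
  by apply: ltr_minima_le; rewrite -(perm_mem pe) mem_cat yL.
have mM : m \in M by rewrite mem_rev.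
exists m => //; rewrite ltn_neqAle my andbT; apply: contraTneq uLM => my'.
by rewrite cat_uniq; apply/negP => /and3P[_ /hasPn/(_ _ mM)]; rewrite /= my' yL.
Qed.

Lemma mem_ltr_minima w q : uniq w -> q < size w ->
  (nth 0 w q \in ltr_minima w) = all (ltn (nth 0 w q)) (take q w).
Proof.
move=> uw qw; apply/mapP/idP => [[i]|minq]; last first.
  by exists q; rewrite // mem_filter mem_iota minq.
rewrite mem_filter mem_iota add0n => /andP[mini iw] /eqP.
by rewrite nth_uniq // => /eqP ->.
Qed.

(** The values of phi, for an arbitrary word (see [phi_word]). *)
Definition word w := [seq (row w x).+1 | x <- w].

Lemma size_word w : size (word w) = size w.
Proof. exact: size_map. Qed.

Lemma nth_word w i : i < size w -> nth 0 (word w) i = (row w (nth 0 w i)).+1.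
Proof. by move=> iw; rewrite (nth_map 0). Qed.

(** Read on the word of blocks, this says that the entry at p is not separated
    by the time the entry at q has been read. *)
Definition unbroken r p q := all (geq (nth 0 r p)) (drop p (take q.+1 r)).

Lemma unbrokenP r p q : q < size r ->
  reflect (forall s, p <= s <= q -> nth 0 r s <= nth 0 r p) (unbroken r p q).
Proof.
move=> qr; apply: (iffP (all_nthP 0)) => H s.
  move=> /andP[ps sq]; have := H (s - p).
  rewrite nth_drop size_drop size_takel // subnKC // nth_take //; apply; lia.
rewrite size_drop size_takel // => sp; rewrite nth_drop nth_take /=; last lia.
by apply: H; lia.
Qed.

Lemma separated_unbroken w p q : uniq w -> p < q -> q < size w ->
  ~~ separated (rcons (take q w) (nth 0 w q)) (nth 0 w p) = unbroken (word w) p q.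
Proof.
move=> uw pq qw; have pw := ltn_trans pq qw.
rewrite -take_nth // /separated /unbroken /word -map_take -map_drop all_map.
have -> : index (nth 0 w p) (take q.+1 w) = p.
  by rewrite -(nth_take 0 (n0 := q.+1)) ?index_uniq ?take_uniq ?size_takel // ltnS ltnW.
rewrite -all_predC; apply: eq_in_all => z zd /=.
have rowE x : x \in take q.+1 w -> row (take q.+1 w) x = row w x.
  by move=> xw; rewrite -{2}(cat_take_drop q.+1 w) row_cat.
rewrite (nth_map 0) // -leqNgt ltnS !rowE //; last exact: mem_drop zd.
by rewrite -(nth_take 0 (n0 := q.+1)) ?mem_nth ?size_takel // ltnS ltnW.
Qed.

(** Blocks are stable under extension of the word, so the prefixes by which
    [well_placed] is defined can be replaced by the whole word. *)
Lemma well_placedP w : uniq w ->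
  reflect (forall p q, p < q -> q < size w ->
             nth 0 w p \notin ltr_minima w -> nth 0 w q \notin ltr_minima w ->
             (nth 0 w p < nth 0 w q) = unbroken (word w) p q)
          (well_placed w).
Proof.
move=> uw; have minE p q : p < q -> q < size w ->
    (nth 0 w p \in ltr_minima (take q w)) = (nth 0 w p \in ltr_minima w).
  move=> pq qw; have pw := ltn_trans pq qw; rewrite mem_ltr_minima //.
  rewrite -(nth_take 0 (n0 := q)) // mem_ltr_minima ?take_uniq ?size_takel //.
  - by rewrite nth_take // take_takel // ltnW.
  - exact: ltnW.
apply: (iffP allP) => [H p q pq qw pm qm|H q].
  have := H q; rewrite mem_iota add0n qw => /(_ isT).
  rewrite -mem_ltr_minima // (negbTE qm) => /(all_nthP 0)/(_ p).
  rewrite size_takel ?nth_take // => [/(_ pq)|]; last exact: ltnW.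
  by rewrite minE // (negbTE pm) separated_unbroken // => /eqP.
rewrite mem_iota add0n => qw; rewrite -mem_ltr_minima //.
case: (boolP (nth 0 w q \in _)) => //= qm; apply/(all_nthP 0) => p.
rewrite size_takel; last exact: ltnW.
move=> pq; rewrite nth_take // minE // separated_unbroken //.
by case: (boolP (nth 0 w p \in _)) => //= pm; rewrite H.
Qed.

Lemma nth_decreasing_count s x i : sorted gtn s -> i < size s ->
  (x < nth 0 s i) = (i < count (ltn x) s).
Proof.
elim: s i => // a s IH i /=; rewrite (path_sortedE gtn_trans) => /andP[sa ss].
case: (ltnP x a) => [xa|ax]; first by case: i => [|i] //= /IH ->.
rewrite (eq_in_count (a2 := pred0)) ?count_pred0 => [|b bs /=]; last first.
  by rewrite ltnNge (leq_trans (ltnW (allP sa _ bs))).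
case: i => [|i] /=; rewrite ?ltn0 ?(ltnNge x) ?ax // ltnS => i_s.
by rewrite (leq_trans (ltnW (allP sa _ (mem_nth 0 i_s)))).
Qed.

Lemma row_lt_size w x : x \in w -> row w x < size (ltr_minima w).
Proof.
move=> /ltr_minima_le[m mm mx]; rewrite /row -(count_predC (ltn x) (ltr_minima w)).
rewrite -[X in X < _]addn0 ltn_add2l -has_count; apply/hasP; exists m => //=.
by rewrite -leqNgt.
Qed.

Lemma blockE w x : x \in w -> block (ltr_minima w) x = (row w x).+1.
Proof.
move=> xw; have [bl inb] := blockP xw.
apply: (in_block_inj bl _ inb); first by rewrite ltnS row_lt_size.
have sm := ltr_minima_sorted w; rewrite /in_block /= leqNgt.
rewrite nth_decreasing_count ?row_lt_size // ltnn /= eqSS.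
case E: (row w x) => [|k] //=; rewrite nth_decreasing_count //; first by rewrite -/(row w x) E.
by apply: ltn_trans (row_lt_size xw); rewrite E.
Qed.

Lemma phi_word n (pi : 'S_n) : phi pi = word (oneline pi) :> seq nat.
Proof.
apply: (@eq_from_nth _ 0) => [|i]; rewrite ?size_word !size_tuple // => i_n.
rewrite nth_word ?size_tuple // -blockE ?mem_nth ?size_tuple //.
by rewrite -[i]/(val (Ordinal i_n)) -tnth_nth tnth_mktuple -tnth_nth.
Qed.

(** Restricted growth as the occurrence of all smaller values beforehand, a form
    that avoids the maximum over a prefix. *)
Definition rgf (r : seq nat) := forall i, i < size r ->
  0 < nth 0 r i /\ forall v, 0 < v < nth 0 r i -> exists2 j, j < i & nth 0 r j = v.

(** If v is below the letter at i, the maximum before i is at least v, so some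
    earlier letter reaches v; descending along such letters ends at v itself. *)
Lemma is_rgfP n (r : n.-tuple nat) : is_rgf r <-> rgf r.
Proof.
split=> [/forallP H|H].
  have pos i : i < size r -> 0 < nth 0 r i.
    rewrite size_tuple => i_n; have := H (Ordinal i_n).
    by rewrite (tnth_nth 0) /=; case: ifP => [_ /eqP -> //|_ /andP[]].
  move=> i i_r; split; first exact: pos.
  elim/ltn_ind: i i_r => i IH i_r v /andP[v0 vi].
  move: i_r (i_r); rewrite {1}size_tuple => i_n i_r.
  have := H (Ordinal i_n); rewrite (tnth_nth 0) /=; case: ifP => [_ /eqP e|i0]; first by lia.
  case/andP=> _ le; have [j ji vj] : exists2 j : 'I_n, j < i & v <= tnth r j.
    apply/exists_inP; apply: contraT; rewrite negb_exists => /forallP A.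
    rewrite add1n in le; have := leq_trans vi le.
    rewrite ltnS leqNgt => /negP[].
    rewrite -(prednK v0) ltnS; apply/bigmax_leqP => j ji.
    by have := A j; rewrite ji /= -ltnNge; case: v v0 {A vi} => //.
  move: vj; rewrite (tnth_nth 0) leq_eqVlt => /predU1P[->|vj]; first by exists (val j).
  have [||k kj <-] := IH j ji _ v; rewrite ?v0 ?size_tuple //.
  by exists k => //; apply: ltn_trans kj ji.
apply/forallP => i; rewrite (tnth_nth 0).
have [|pos low] := H i; first by rewrite size_tuple.
case: eqP => [i0|_].
  rewrite eqn_leq pos andbT leqNgt; apply/negP => /(low 1)[j].
  by rewrite i0.
rewrite pos; case: (posnP (nth 0 r i).-1) => [|r1]; first by lia.
have [|j ji e] := low (nth 0 r i).-1; first by lia.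
have jn := ltn_trans ji (ltn_ord i).
rewrite add1n -(prednK pos) -e ltnS; apply: (bigmax_sup (Ordinal jn)) => //.
by rewrite (tnth_nth 0).
Qed.

Lemma row_nth_minima w k : k < size (ltr_minima w) ->
  row w (nth 0 (ltr_minima w) k) = k.
Proof.
have sm := ltr_minima_sorted w => km; apply/eqP; rewrite eqn_leq; apply/andP; split.
  by rewrite leqNgt -nth_decreasing_count // ltnn.
case: k km => // k km; rewrite -nth_decreasing_count //; last exact: ltnW.
by apply: (sorted_ltn_nth gtn_trans 0 sm); rewrite // inE ltnW.
Qed.

(** A block of smaller index than that of x is opened by a minimum larger than
    x, which must precede x. *)
Lemma word_rgf w : uniq w -> rgf (word w).
Proof.
move=> uw i; rewrite size_word => iw; rewrite nth_word //; split=> // -[//|k].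
move=> /andP[_]; rewrite ltnS => ki; set x := nth 0 w i in ki *.
have xw : x \in w by apply: mem_nth.
have sm := ltr_minima_sorted w.
have km : k < size (ltr_minima w) := ltn_trans ki (row_lt_size xw).
set m := nth 0 (ltr_minima w) k.
have xm : x < m by rewrite /m nth_decreasing_count.
have mm : m \in ltr_minima w by apply: mem_nth.
have mw : m \in w by apply: (mem_subseq (ltr_minima_subseq w)).
exists (index m w); last by rewrite nth_word ?index_mem // nth_index // row_nth_minima.
rewrite ltnNge leq_eqVlt negb_or; apply/andP; split.
  by apply/eqP => e; move: xm; rewrite /x e nth_index ?ltnn.
apply/negP => im; move: mm; rewrite -(nth_index 0 mw) mem_ltr_minima ?index_mem //.
rewrite nth_index // => /allP/(_ x) /= H; move: xm; rewrite ltnNge ltnW // H //.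
by rewrite /x -(nth_take 0 im) mem_nth // size_takel // ltnW ?index_mem.
Qed.

Lemma row_word_lt w p q : p < size w -> q < size w ->
  nth 0 (word w) p < nth 0 (word w) q -> nth 0 w q < nth 0 w p.
Proof.
move=> pw qw; rewrite !nth_word // ltnS row_lt => /hasP[m _ /andP[]].
exact: leq_trans.
Qed.

(** An entry q below the minimum p would be cut off from the block of p by p
    itself. *)
Lemma minimum_first w p q : p < size w -> q < size w ->
  nth 0 w p \in ltr_minima w -> nth 0 (word w) p = nth 0 (word w) q ->
  nth 0 w p <= nth 0 w q.
Proof.
move=> pw qw pm; rewrite !nth_word // => -[e]; rewrite leqNgt; apply/negP => qp.
suff : row w (nth 0 w p) < row w (nth 0 w q) by rewrite e ltnn.
by rewrite row_lt; apply/hasP; exists (nth 0 w p); rewrite // qp leqnn.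
Qed.

(** Each block is opened by its minimum, so the minima are at the first
    occurrences of the values of the word.  If an earlier entry were below a
    first occurrence, it would belong to the same or a later block, and then
    the restricted growth property would give an earlier occurrence. *)
Lemma minimaP w p : uniq w -> p < size w ->
  (nth 0 w p \in ltr_minima w) = (nth 0 (word w) p \notin take p (word w)).
Proof.
move=> uw pw; rewrite mem_ltr_minima //; apply/idP/idP => [pmin|].
  apply/negP => /(nthP 0)[u]; rewrite size_takel ?size_word ?(ltnW pw) // => up.
  have uw' := ltn_trans up pw; rewrite nth_take // !nth_word // => -[e].
  have uin : nth 0 w u \in take p w.
    by rewrite -(nth_take 0 up) mem_nth // size_takel // ltnW.
  have [m mm mu] := ltr_minima_le uin.
  suff : row w (nth 0 w u) < row w (nth 0 w p) by rewrite e ltnn.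
  rewrite row_lt; apply/hasP; exists m.
    have [t eq_t _] := ltr_minima_cat (take p w) (drop p w).
    by rewrite -(cat_take_drop p w) eq_t mem_cat mm.
  rewrite mu andbT; apply: (allP pmin).
  by rewrite (mem_subseq (ltr_minima_subseq _)).
move=> pfirst; apply/(all_nthP 0) => u; rewrite size_takel ?(ltnW pw) // => up.
have uw' := ltn_trans up pw; rewrite nth_take //= ltnNge; apply/negP => le.
have rle : nth 0 (word w) p <= nth 0 (word w) u.
  rewrite leqNgt; apply/negP => /(row_word_lt uw' pw).
  by rewrite ltnNge le.
have key j : j < p -> nth 0 (word w) j <> nth 0 (word w) p.
  move=> jp e; case/negP: pfirst; rewrite -e -(nth_take 0 jp) mem_nth //.
  by rewrite size_takel // size_word ltnW.
move: rle; rewrite leq_eqVlt => /predU1P[e|lt]; first exact: (key _ up (esym e)).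
have uw2 : u < size (word w) by rewrite size_word.
have [_ /(_ (nth 0 (word w) p))[|j ju /key []]] := word_rgf uw uw2.
  by rewrite lt {1}nth_word.
exact: ltn_trans up.
Qed.

(** For p < q, whether the entry at p is the smaller one: earlier blocks have
    the larger entries; inside a block the minimum comes first, and two
    non-minima ascend unless separated. *)
Definition before (r : seq nat) p q :=
  if nth 0 r p == nth 0 r q then (nth 0 r p \notin take p r) || unbroken r p q
  else nth 0 r q < nth 0 r p.

(** Different blocks are disjoint intervals of values; within a block, a minimum
    at p is below everything, and otherwise both entries are non-minima. *)
Lemma well_placed_before w p q : uniq w -> well_placed w -> p < q -> q < size w ->
  (nth 0 w p < nth 0 w q) = before (word w) p q.
Proof.
move=> uw /(well_placedP uw) gw pq qw; have pw := ltn_trans pq qw; rewrite /before.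
case: (ltngtP (nth 0 (word w) p)) => [/row_word_lt H | /row_word_lt -> // | e].
  by rewrite ltnNge ltnW ?H.
have neq : nth 0 w p != nth 0 w q by rewrite nth_uniq // ltn_eqF.
case: (boolP (_ \in _)) => /= pm; last first.
  by rewrite ltn_neqAle neq minimum_first // minimaP.
apply: gw => //; rewrite minimaP ?negbK //.
rewrite -e -(nth_take 0 pq) mem_nth // size_takel // size_word.
exact: ltnW.
Qed.

(** The criterion compares all non-minima, [before] only decides inside blocks;
    the second hypothesis, which is avoidance of 12231, covers a pair whose
    second entry lies in an earlier block. *)
Lemma before_well_placed w : uniq w ->
  (forall p q, p < q -> q < size w -> (nth 0 w p < nth 0 w q) = before (word w) p q) ->
  (forall p q, p < q -> q < size w -> nth 0 (word w) p \in take p (word w) ->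
     nth 0 (word w) q < nth 0 (word w) p -> unbroken (word w) p q) ->
  well_placed w.
Proof.
move=> uw H av; apply/well_placedP => // p q pq qw; have pw := ltn_trans pq qw.
rewrite !minimaP // !negbK => pn qn; rewrite H // /before pn.
case: (ltngtP (nth 0 (word w) p)) => //= lt; last by rewrite av.
apply/esym/negbTE/negP => /unbrokenP; rewrite size_word => /(_ qw q).
by rewrite leqnn (ltnW pq) leqNgt lt => /(_ isT).
Qed.

(** * The pattern 12231 *)

Lemma subseqP_nth (r s : seq nat) :
  reflect (exists2 idx, sorted ltn idx && all (gtn (size r)) idx & s = map (nth 0 r) idx)
          (subseq s r).
Proof.
apply: (iffP idP) => [/subseqP[m sm ->]|[idx /andP[sidx /allP lt] ->]].
  exists (mask m (iota 0 (size r))); last by rewrite map_mask map_nth_iota0 ?take_size.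
  rewrite sorted_mask ?iota_ltn_sorted //=; last exact: ltn_trans.
  by apply/allP => i /mem_mask; rewrite mem_iota.
rewrite -[X in subseq _ X](mkseq_nth 0); apply: map_subseq.
rewrite (_ : idx = [seq i <- iota 0 (size r) | i \in idx]) ?filter_subseq //.
apply: (irr_sorted_eq ltn_trans ltnn) => // [|i].
  by rewrite sorted_filter ?iota_ltn_sorted //; exact: ltn_trans.
rewrite mem_filter mem_iota; case: (boolP (i \in idx)) => //= /lt.
by rewrite add0n.
Qed.

Lemma contains12231P (r : seq nat) :
  reflect (exists a b c, subseq [:: a; b; b; c; a] r /\ a < b < c)
          (rgf_contains r [:: 1; 2; 2; 3; 1]).
Proof.
apply: (iffP (rgf_containsP _ _)) => [[s sr]|[a [b [c [sub /andP[ab bc]]]]]].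
  case: s sr => [|a1 [|b1 [|b2 [|c [|a2 [|? ?]]]]]] //; rewrite /std.
  set s := [:: _; _; _; _; _]; set t := sort _ _ => sr [i1 i2 i3 i4 i5].
  have mt x : (x \in t) = (x \in s) by rewrite mem_sort mem_undup.
  have st : sorted leq t by apply: sort_sorted; exact: leq_total.
  have lt x y : x \in s -> y \in s -> index x t < index y t -> x < y.
    move=> xs ys ixy; rewrite ltn_neqAle (sorted_ltn_index leq_trans st) ?mt // andbT.
    by apply: contraTneq ixy => ->; rewrite ltnn.
  have eq x y : x \in s -> y \in s -> index x t = index y t -> x = y.
    by move=> xs ys e; rewrite -(nth_index 0 (s := t) (x := x)) ?mt // e nth_index ?mt.
  have [ms1 ms2 ms3 ms4 ms5] : [/\ a1 \in s, b1 \in s, b2 \in s, c \in s & a2 \in s].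
    by rewrite /s !inE !eqxx !orbT.
  have ea : a2 = a1 by apply: eq; rewrite ?i5.
  have eb : b2 = b1 by apply: eq; rewrite ?i3.
  exists a1, b1, c; split; first by move: sr; rewrite /s ea eb.
  by apply/andP; split; apply: lt; rewrite // ?i1 ?i2 ?i4.
exists [:: a; b; b; c; a] => //; rewrite /std.
have -> : sort leq (undup [:: a; b; b; c; a]) = [:: a; b; c].
  apply: (sorted_eq leq_trans anti_leq).
  - exact/sort_sorted/leq_total.
  - by rewrite /= (ltnW ab) (ltnW bc).
  rewrite perm_sort; apply: uniq_perm; first exact: undup_uniq.
    by rewrite /= !inE; lia.
  by move=> x; rewrite mem_undup !inE; case: (x == a); case: (x == b); case: (x == c).
by rewrite /= !eqxx (ltn_eqF ab) (ltn_eqF bc) (ltn_eqF (ltn_trans ab bc)).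
Qed.

(** * Permutations with a given word of blocks *)

(** At the first position where r and r' disagree, the smaller of the two
    letters occurs earlier in the function with the larger letter, hence at a
    common position, where the two comparisons differ. *)
Lemma rgf_eq (r r' : seq nat) : size r = size r' -> rgf r -> rgf r' ->
  (forall p q, p < size r -> q < size r ->
     (nth 0 r p < nth 0 r q) = (nth 0 r' p < nth 0 r' q)) ->
  r = r'.
Proof.
move=> sz rr rr' cmp; apply: (@eq_from_nth _ 0) => // i.
elim/ltn_ind: i => i IH ir; have ir' : i < size r' by rewrite -sz.
have [pos low] := rr _ ir; have [pos' low'] := rr' _ ir'.
case: (ltngtP (nth 0 r i) (nth 0 r' i)) => // lt.
  have [|j ji e] := low' (nth 0 r i); first by rewrite pos.
  have jr := ltn_trans ji ir; have := cmp j i jr ir.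
  by rewrite e lt IH // e ltnn.
have [|j ji e] := low (nth 0 r' i); first by rewrite pos'.
have jr := ltn_trans ji ir; have := cmp j i jr ir.
by rewrite e lt -IH // e ltnn.
Qed.

(** The order prescribed by [before r] puts minima exactly at the first
    occurrences of letters of r, so a minimum cuts between two entries exactly
    when their letters differ.  Thus r and the word of blocks of w have the
    same comparisons, and [rgf_eq] applies. *)
Lemma order_rgf w r : uniq w -> size r = size w -> rgf r ->
  (forall p q, p < q -> q < size w -> (nth 0 w p < nth 0 w q) = before r p q) ->
  word w = r.
Proof.
move=> uw szr rr H.
have desc p q : p < size w -> q < size w -> nth 0 r p < nth 0 r q -> nth 0 w q < nth 0 w p.
  move=> pw qw lt; case: (ltngtP p q) => [pq|qp|e]; last by rewrite e ltnn in lt.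
    rewrite ltn_neqAle nth_uniq // gtn_eqF //= leqNgt H // /before ltn_eqF //.
    by rewrite ltnNge ltnW.
  by rewrite H // /before gtn_eqF.
have first_le u q : u < size w -> q < size w -> nth 0 r u \notin take u r ->
    nth 0 r u = nth 0 r q -> nth 0 w u <= nth 0 w q.
  move=> uw' qw fu e; case: (ltngtP u q) => [uq|qu|-> //].
    by apply: ltnW; rewrite H // /before e eqxx -e fu.
  case/negP: fu; rewrite e -(nth_take 0 qu) mem_nth // size_takel // szr.
  exact: ltnW.
have indexE x : x \in r -> [/\ index x r < size w, nth 0 r (index x r) = x
                          & nth 0 r (index x r) \notin take (index x r) r].
  move=> xr; rewrite nth_index // -szr index_mem; split=> //.
  by apply/negP => /index_ltn; rewrite ltnn.
(* The minima of w are at the first occurrences in r. *)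
have minE u : u < size w -> (nth 0 w u \in ltr_minima w) = (nth 0 r u \notin take u r).
  move=> uw'; rewrite mem_ltr_minima //; apply/idP/idP => [umin|ufirst].
    apply/negP => ut; have ur := mem_take ut; have [xw ex fx] := indexE _ ur.
    have xu : index (nth 0 r u) r < u by apply: index_ltn.
    have := first_le _ _ xw uw' fx ex; rewrite leqNgt => /negP[]; apply: (allP umin).
    by rewrite -(nth_take 0 xu) mem_nth // size_takel // ltnW.
  apply/(all_nthP 0) => v; rewrite size_takel ?(ltnW uw') // => vu /=.
  have vw := ltn_trans vu uw'; rewrite nth_take //.
  apply: desc => //.
  have nfirst j : j < u -> nth 0 r j <> nth 0 r u.
    move=> ju e; case/negP: ufirst; rewrite -e -(nth_take 0 ju) mem_nth //.
    by rewrite size_takel // szr ltnW.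
  case: ltngtP => // [lt|e]; last by case: (nfirst v vu).
  have vr : v < size r by rewrite szr.
  have ur : u < size r by rewrite szr.
  have [_ /(_ (nth 0 r u))[|j jv /nfirst []]] := rr v vr.
    by rewrite lt; have [-> _] := rr u ur.
  exact: ltn_trans vu.
apply: rgf_eq; rewrite ?size_word //; first exact: word_rgf.
move=> p q pw qw; rewrite !nth_word // ltnS row_lt.
have pr : nth 0 r p \in r by rewrite mem_nth ?szr.
apply/hasP/idP => [[m mm /andP[qm mp]]|lt].
  have mw := mem_subseq (ltr_minima_subseq w) mm.
  move: mm mp qm; rewrite -(nth_index 0 mw); set u := index m w.
  have uw' : u < size w by rewrite index_mem.
  rewrite minE // => fu up qu.
  have pu : nth 0 r p <= nth 0 r u.
    by rewrite leqNgt; apply/negP => /(desc _ _ uw' pw); rewrite ltnNge up.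
  have uq : nth 0 r u <= nth 0 r q.
    by rewrite leqNgt; apply/negP => /(desc _ _ qw uw'); rewrite ltnNge ltnW.
  apply: leq_ltn_trans pu _; rewrite ltn_neqAle uq andbT; apply/eqP => e.
  by move: qu; rewrite ltnNge first_le.
have [uw' ue fu] := indexE _ pr.
exists (nth 0 w (index (nth 0 r p) r)); first by rewrite minE.
by rewrite desc ?ue // first_le.
Qed.

Lemma lexi_ltn B a b c d : c < B -> d < B ->
  (a * B + c < b * B + d) = (a < b) || (a == b) && (c < d).
Proof.
move=> cB dB; case: (ltngtP a b) => [ab|ba|->] /=; last by rewrite ltn_add2l.
  have : a.+1 * B <= b * B by rewrite leq_mul2r ab orbT.
  by rewrite mulSn; lia.
have : b.+1 * B <= a * B by rewrite leq_mul2r ba orbT.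
by rewrite mulSn; lia.
Qed.

(** A rank for the groups into which breaks cut a block: within a block it is
    constant on each group and grows from one group to the next.  The successor
    leaves 0 for positions without a break before them. *)
Definition last_break (r : seq nat) p :=
  \max_(s < p | nth 0 r p < nth 0 r s) s.+1.

Lemma last_break_le r p : last_break r p <= p.
Proof. by apply/bigmax_leqP => s _. Qed.

(** On the positions of one block the last break is weakly increasing, and it
    moves exactly when a break occurs in between. *)
Lemma unbroken_last_break r p q : p < q -> q < size r -> nth 0 r p = nth 0 r q ->
  unbroken r p q = (last_break r q <= last_break r p).
Proof.
move=> pq qr e; apply/unbrokenP/bigmax_leqP => // [H s|H s /andP[ps]].
  rewrite -e => lt; case: (ltnP s p) => [sp|ps].
    exact: (bigmax_sup (Ordinal sp)).
  by have := H s; rewrite ps (ltnW (ltn_ord s)) leqNgt lt => /(_ isT).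
rewrite leq_eqVlt => /predU1P[->|sq]; first by rewrite e.
rewrite leqNgt; apply/negP => lt.
have := H (Ordinal sq); rewrite -e /= => /(_ lt) /leq_trans/(_ (last_break_le r p)).
by rewrite ltnNge ps.
Qed.

(** Lexicographic rank in mixed radix.  In order of priority: earlier blocks
    are larger; the first position of a block is its smallest; a later last
    break means smaller; and positions sharing the last break ascend. *)
Definition key (r : seq nat) p :=
  (((\max_(x <- r) x - nth 0 r p) * 2 + (nth 0 r p \in take p r)) * (size r).+1
    + (size r - last_break r p)) * (size r).+1 + p.

Lemma key_before r p q : p < q -> q < size r -> (key r p < key r q) = before r p q.
Proof.
move=> pq qr; have pr := ltn_trans pq qr.
have le_max i : i < size r -> nth 0 r i <= \max_(x <- r) x.
  move=> ir; apply: (leq_bigmax_seq (F := id)) => //; exact: mem_nth.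
have flag (b : bool) : b < 2 by case: b.
rewrite /key lexi_ltn ?ltnS ?(ltnW pr) ?(ltnW qr) //.
have subL i j : i < size r -> j < size r -> nth 0 r j < nth 0 r i ->
    \max_(x <- r) x - nth 0 r i < \max_(x <- r) x - nth 0 r j.
  by move=> ir jr lt; apply: ltn_sub2l => //; apply: leq_trans lt (le_max _ ir).
rewrite pq andbT orbC -leq_eqVlt leqNgt lexi_ltn ?ltnS ?leq_subr //.
rewrite /before; case: (ltngtP (nth 0 r p)) => [lt|lt|e].
- by rewrite lexi_ltn ?flag // subL.
- set X := _ * 2 + _; set Y := _ * 2 + _.
  have YX : Y < X by rewrite lexi_ltn ?flag // subL.
  by rewrite ltnNge ltnW //= gtn_eqF.
have -> : nth 0 r q \in take q r.
  by rewrite -e -(nth_take 0 pq) mem_nth // size_takel // ltnW.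
rewrite e unbroken_last_break //; case: (_ \in take p r) => /=.
  rewrite ltnn eqxx /= -leqNgt.
  rewrite leq_sub2lE // (leq_trans (last_break_le r q)) //; exact: ltnW.
by rewrite addn0 addn1 ltnNge leqnSn /= gtn_eqF.
Qed.

Lemma perm_of_key n (K : 'I_n -> nat) : injective K ->
  exists pi : 'S_n, forall i j, (pi i < pi j) = (K i < K j).
Proof.
move=> injK; pose rank i := #|[set j | K j < K i]|.
have mono i j : K i < K j -> rank i < rank j.
  move=> ij; apply: proper_card; apply/properP; split.
    by apply/subsetP => k; rewrite !inE => /ltn_trans; apply.
  by exists i; rewrite !inE ?ltnn.
have rank_n i : rank i < n.
  rewrite -[X in _ < X]card_ord -cardsT; apply: proper_card; apply/properP.
  by split; [exact: subsetT | exists i; rewrite !inE ?ltnn].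
have cmp i j : (rank i < rank j) = (K i < K j).
  case: (ltngtP (K i) (K j)) => [/mono -> // | /mono H | /injK ->].
    by rewrite ltnNge ltnW.
  by rewrite ltnn.
have inj : injective (fun i => Ordinal (rank_n i)).
  move=> i j [e]; apply: injK; case: (ltngtP (K i) (K j)) => // /mono.
    by rewrite e ltnn.
  by rewrite e ltnn.
by exists (perm inj) => i j; rewrite !permE /= cmp.
Qed.

(** An entry of a permutation is the number of smaller entries. *)
Lemma perm_order_inj n (s t : 'S_n) :
  (forall i j, (s i < s j) = (t i < t j)) -> s = t.
Proof.
have countE (u : 'S_n) i : u i = \sum_(j < n) (u j < u i) :> nat.
  have <- : \sum_(k < n) (k < u i) = \sum_(j < n) (u j < u i).
    by rewrite (reindex_inj (@perm_inj _ u)).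
  rewrite (eq_bigr (fun k : 'I_n => if k < u i then 1 else 0)); last first.
    by move=> k _; case: (k < u i).
  rewrite -big_mkcond -(big_ord_widen n (fun=> 1)) ?sum1_card ?card_ord //.
  exact: ltnW.
move=> H; apply/permP => i; apply: val_inj.
rewrite /= (countE s) (countE t).
by apply: eq_bigr => j _; rewrite H.
Qed.

(** * The bijection *)

Lemma oneline_perm n (pi : 'S_n) : perm_eq (oneline pi) (iota 1 (size (oneline pi))).
Proof.
have u : uniq (oneline pi).
  rewrite /= map_inj_uniq ?enum_uniq // => i j /succn_inj /val_inj.
  exact: perm_inj.
have [] := uniq_min_size (s1 := oneline pi) (s2 := iota 1 (size (oneline pi))) u.
- move=> x /mapP[i _ ->]; rewrite mem_iota size_tuple add1n ltnS.
  exact: ltn_ord.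
- by rewrite size_iota.
by move=> _ H; apply: uniq_perm; rewrite ?iota_uniq.
Qed.

Lemma nth_oneline n (pi : 'S_n) (i : 'I_n) : nth 0 (oneline pi) i = (pi i).+1.
Proof. by rewrite -tnth_nth tnth_mktuple. Qed.

(** In an occurrence a, b, b, c, a the second b and the second a are not first
    occurrences, hence belong to non-minima, and the entry with letter a is the
    larger one because its block comes first.  But c in between separates. *)
Lemma well_placed_avoids w : uniq w -> well_placed w ->
  ~~ rgf_contains (word w) [:: 1; 2; 2; 3; 1].
Proof.
move=> uw gw; apply/negP => /contains12231P[a [b [c [/subseqP_nth]]]].
case=> -[|p0 [|p1 [|p2 [|p3 [|p4 [|? ?]]]]]] //=.
rewrite size_word => /andP[/and5P[p01 p12 p23 p34 _] /and5P[w0 w1 w2 w3 /andP[w4 _]]].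
case=> e0 e1 e2 e3 e4 /andP[ab bc].
have later p q : p < q -> q < size w -> nth 0 (word w) p = nth 0 (word w) q ->
    nth 0 w q \notin ltr_minima w.
  move=> pq qw e; rewrite minimaP // negbK -e -(nth_take 0 pq) mem_nth //.
  by rewrite size_takel // size_word ltnW.
have p24 := ltn_trans p23 p34.
have := row_word_lt w4 w2; rewrite -e2 -e4 ab => /(_ isT) lt.
have := (well_placedP uw gw) p2 p4 p24 w4; rewrite lt.
rewrite (later p1) ?(later p0) -?e0 -?e1 //; last first.
  by apply: ltn_trans p24; apply: ltn_trans p12.
move=> /(_ isT isT) /esym /unbrokenP; rewrite size_word => /(_ w4 p3).
by rewrite -e2 -e3 (leqNgt c) bc (ltnW p23) (ltnW p34) => /(_ isT).
Qed.

(** A break s between p and q completes a 12231: the first occurrence of the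
    letter of p comes before p, and by restricted growth the smaller letter of
    q occurs before that. *)
Lemma avoids_unbroken r p q : rgf r -> ~~ rgf_contains r [:: 1; 2; 2; 3; 1] ->
  p < q -> q < size r -> nth 0 r p \in take p r -> nth 0 r q < nth 0 r p -> unbroken r p q.
Proof.
move=> rr av pq qr pt lt; apply/unbrokenP => // s /andP[ps sq]; rewrite leqNgt.
apply: contra av => ls; apply/contains12231P.
have pr := ltn_trans pq qr.
have xr := mem_take pt; set u := index (nth 0 r p) r.
have ur : u < size r by rewrite index_mem.
have up : u < p := index_ltn pt.
have [_ /(_ (nth 0 r q))[|j ju e]] := rr u ur.
  by rewrite nth_index // lt; have [-> _] := rr q qr.
exists (nth 0 r q), (nth 0 r p), (nth 0 r s); rewrite lt ls; split=> //.
apply/subseqP_nth; exists [:: j; u; p; s; q]; last by rewrite /= e nth_index.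
rewrite /= ju up /= pr qr ur (ltn_trans ju ur) (leq_ltn_trans sq qr) !andbT.
apply/andP; split; rewrite ltn_neqAle ?ps ?sq andbT.
  by apply: contraTneq ls => ->; rewrite ltnn.
by apply: contraTneq ls => ->; rewrite -leqNgt ltnW.
Qed.

Theorem theorem4p9 (n : nat) :
  [/\ {in Sort132 n, forall pi, phi pi \in RGF_avoiding n [:: 1; 2; 2; 3; 1]},
      {in Sort132 n &, injective (@phi n)}
    & {in RGF_avoiding n [:: 1; 2; 2; 3; 1],
        forall r, exists2 pi, pi \in Sort132 n & phi pi = r}].
Proof.
have uniq_oneline (pi : 'S_n) : uniq (oneline pi).
  by rewrite (perm_uniq (oneline_perm pi)) iota_uniq.
have sortE pi : (pi \in Sort132 n) = well_placed (oneline pi).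
  by rewrite inE sortable132E // oneline_perm.
have sz (pi : 'S_n) : size (oneline pi) = n by rewrite size_tuple.
split=> [pi|s t|r]; rewrite ?sortE.
- move=> gp; rewrite inE; apply/andP; split.
    by apply/is_rgfP; rewrite phi_word; apply: word_rgf.
  by rewrite phi_word well_placed_avoids.
- move=> gs gt e.
  have ew : word (oneline s) = word (oneline t) by rewrite -!phi_word e.
  have lt_st (i j : 'I_n) : i < j -> (s i < s j) = (t i < t j).
    move=> ij; have := ltn_ord j; rewrite -{2}(sz s) => js.
    have jt : j < size (oneline t) by rewrite sz.
    have := well_placed_before (uniq_oneline s) gs ij js.
    by rewrite ew -well_placed_before // !nth_oneline.
  have neq_lt (u : 'S_n) (i j : 'I_n) : i != j -> (u i < u j) = ~~ (u j < u i).
    by move=> ij; rewrite -leqNgt ltn_neqAle (inj_eq val_inj) (inj_eq perm_inj) ij.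
  apply: perm_order_inj => i j; case: (ltngtP i j) => [/lt_st // | ji | /val_inj ->].
    by rewrite !(neq_lt _ i j) ?lt_st // -val_eqE gtn_eqF.
  by rewrite !ltnn.
rewrite inE => /andP[/is_rgfP rr av].
have sr : size r = n := size_tuple r.
have keyE (i j : 'I_n) : i < j -> (key r i < key r j) = before r i j.
  by move=> ij; rewrite key_before // sr.
have key_inj : injective (fun i : 'I_n => key r i).
  move=> i j /(congr1 (modn^~ (size r).+1)).
  by rewrite /key !modnMDl !modn_small ?ltnS ?sr 1?ltnW // => /val_inj.
have [pi pi_key] := perm_of_key key_inj.
have order p q : p < q -> q < size (oneline pi) ->
    (nth 0 (oneline pi) p < nth 0 (oneline pi) q) = before r p q.
  rewrite sz => pq qn; have pn := ltn_trans pq qn.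
  rewrite -[p]/(val (Ordinal pn)) -[q]/(val (Ordinal qn)) !nth_oneline ltnS pi_key.
  exact: keyE.
have ew : word (oneline pi) = r.
  by apply: order_rgf order; rewrite ?sz.
exists pi; last by apply: val_inj; rewrite /= -ew -phi_word.
rewrite sortE; apply: before_well_placed => // p q pq qn.
  by rewrite ew; apply: order.
by rewrite ew; apply: avoids_unbroken; rewrite // sr -(sz pi).
Qed.
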